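(* Let $N,s\ge 1$ be integers, let $C>1$ and $0<\varepsilon<\frac1{12}$, and suppose that $$f=4C(1+\varepsilon)(s^2+1)\log N$$ is an integer with $0<f<N$. Let $\Omega$ be chosen uniformly at random among the subsets of $\mathbb{Z}/N\mathbb{Z}$ of cardinality $f$. Let $\nu\ge 3$ be an arbitrary integer, $a=\cos\frac{\pi}{\nu}$ and $\delta=Ca^2-1$. Then $$P\big(\text{every } x:\mathbb{Z}/N\mathbb{Z}\to\mathbb{C} \text{ with } \|x\|_0\le s \text{ has property (i)}\big)>1-\nu N^{-\delta}-N^{-C\varepsilon^2(1+\varepsilon)(s^2+1)} .$$ Here $x$ has property (i) (relative to $\Omega$) if for every $y:\mathbb{Z}/N\mathbb{Z}\to\mathbb{C}$ with $y\neq x$ and $\hat y|_\Omega=\hat x|_\Omega$ one has $\|y\|_1>\|x\|_1$.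
   Context: For $x:\mathbb{Z}/N\mathbb{Z}\to\mathbb{C}$: $\|x\|_0$ is the cardinality of the support of $x$, $\|x\|_1=\sum_t|x(t)|$, and $\hat x(\omega)=\frac1{\sqrt N}\sum_{t\in\mathbb{Z}/N\mathbb{Z}}x(t)\exp(-2\pi i t\omega/N)$ for $\omega\in\mathbb{Z}/N\mathbb{Z}$. Property (i) says that $\hat x$ is the unique extension of $\hat x|_\Omega$ of minimal norm in the Wiener algebra, where $\|\hat x\|_A=\|x\|_1$. $\log$ is the natural logarithm. *)

(* Defs.v *)
From HB Require Import structures.
From mathcomp Require Import all_boot all_order all_algebra.
From mathcomp Require Import all_classical all_reals all_analysis.
From mathcomp Require Import complex.

Set Implicit Arguments.
Unset Strict Implicit.
Unset Printing Implicit Defensive.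

Import Order.TTheory GRing.Theory Num.Theory.

Local Open Scope ring_scope.
Local Open Scope complex_scope.

(* Z/NZ is represented by its residues 0 <= t < N, i.e. by 'I_N. This is
   faithful for every N (unlike 'Z_N, which is Z/2Z when N = 1), and the
   Fourier kernel below does not depend on the chosen representatives. *)
Definition signal (R : realType) (N : nat) := {ffun 'I_N -> R[i]}.

(* exp (i theta) *)
Definition expi (R : realType) (theta : R) : R[i] := cos theta +i* sin theta.

Definition fourier (R : realType) (N : nat) (x : signal R N) (w : 'I_N) : R[i] :=
  ((Num.sqrt N%:R)^-1)%:C *
  \sum_(t < N) x t * expi (- (2 * pi * t%:R * w%:R / N%:R)).

Definition l0norm (R : realType) (N : nat) (x : signal R N) : nat :=
  #|[set t | x t != 0]|%SET.

(* [Normc.normc] is the complex modulus with values in R, whereas `|z| has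
   values in R[i]. *)
Definition l1norm (R : realType) (N : nat) (x : signal R N) : R :=
  \sum_(t < N) ComplexField.Normc.normc (x t).

(* As l1norm y is the Wiener-algebra norm of fourier y, this says that fourier x
   is the unique minimal-norm extension of its restriction to Omega. *)
Definition property_i (R : realType) (N : nat) (Omega : {set 'I_N})
    (x : signal R N) : Prop :=
  forall y : signal R N, y <> x ->
    (forall w, w \in Omega -> fourier y w = fourier x w) ->
    l1norm x < l1norm y.

(* Probability that E holds for a set drawn uniformly at random among the
   subsets of T with exactly k elements. It is junk (0) if there is no such
   subset, that is, if #|T| < k. *)
Definition uniform_subset_prob (R : realType) (T : finType) (k : nat)
    (E : {set T} -> Prop) : R :=
  #|[set A : {set T} | (#|A| == k) && `[< E A >]]%SET|%:R /
  #|[set A : {set T} | #|A| == k]%SET|%:R.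

(* Main.v *)
(* The coherence of the random spectrum Omega is controlled through the
   exponential sums K_d = sum_(w in Omega) e(w d / N), 0 < d < N. If h is the
   difference of two signals with the same spectrum on Omega, convolving h with
   K shows |Omega| |h(t)| <= sum_(t' <> t) |K_(t - t')| |h(t')|. When |K_d| <=
   |Omega| / D with D = 2 s - 1/3, this gives 2 s max |h| < ||h||_1, so no set of
   s points carries half of the mass of h, and the sparse signal is the strict
   minimiser. Each |K_d| is compared with the nu projections of K_d on the
   directions of a regular polygon, at the cost of the factor a = cos (pi / nu);
   a projection is a sum over a uniform f-subset, and its deviations obey
   Bernstein's inequality with variance 1/2 by Maclaurin's inequality. If N is
   even, d = N/2 is special: K_d is real and the variance may be 1. There the
   bound |K_d| <= (3/2) |Omega| / D is enough, because every t has a single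
   antipode. A union bound over the N - 1 values of d gives the term
   nu N^-delta; the last term of the statement only makes the inequality
   strict. *)

Require Import Defs.
From HB Require Import structures.
From mathcomp Require Import all_boot all_order all_algebra.
From mathcomp Require Import all_classical all_reals all_analysis.
From mathcomp Require Import complex.
From mathcomp Require Import ring lra zify.

Import Order.TTheory GRing.Theory Num.Theory.

Local Open Scope ring_scope.

Local Notation normc := ComplexField.Normc.normc.

(** * Maclaurin's inequality *)

(** Double counting: a pair [(A, w)] with [w] outside [A] corresponds to the pair [(w |: A, w)]. *)
Lemma sum_subset_add {V : nmodType} {T : finType} (k : nat)
    (F : {set T} -> T -> V) :
  \sum_(A : {set T} | #|A| == k) \sum_(w | w \notin A) F A w =
  \sum_(B : {set T} | #|B| == k.+1) \sum_(w in B) F (B :\ w)%SET w.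
Proof.
rewrite (exchange_big_dep xpredT) //= [RHS](exchange_big_dep xpredT) //=.
apply: eq_bigr => w _.
rewrite [RHS](reindex_onto (fun A : {set T} => w |: A)%SET
  (fun B : {set T} => B :\ w)%SET) /=; last first.
  by move=> B /andP[_ wB]; rewrite finset.setD1K.
apply: eq_big => [A|A /andP[_ wA]]; last by rewrite setU1K.
rewrite cardsU1 setU11 andbT.
case: (boolP (w \in A)) => wA /=; last by rewrite setU1K ?eqxx ?andbT // add1n eqSS.
rewrite andbF; apply/esym/negbTE; rewrite negb_and; apply/orP; right.
by apply: contraTneq wA => <-; rewrite !inE eqxx.
Qed.

Definition elem_sym {R : pzRingType} {T : finType} (y : T -> R) (k : nat) : R :=
  \sum_(A : {set T} | #|A| == k) \prod_(i in A) y i.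

(** Cauchy-Schwarz against the constant 1, read off from the double sum of the squares
    [(y i - y j) ^+ 2]. *)
Lemma sum_sqr_le {R : realFieldType} {T : finType} (P : {set T}) (y : T -> R) :
  (\sum_(i in P) y i) ^+ 2 <= #|P|%:R * \sum_(i in P) y i ^+ 2.
Proof.
have := @sumr_ge0 R T (index_enum T) (fun i => i \in P)
  (fun i => \sum_(j in P) (y i - y j) ^+ 2).
move=> /(_ (fun i _ => sumr_ge0 _ (fun j _ => sqr_ge0 _))).
suff -> : \sum_(i in P) \sum_(j in P) (y i - y j) ^+ 2 =
   2 * (#|P|%:R * \sum_(i in P) y i ^+ 2 - (\sum_(i in P) y i) ^+ 2) by lra.
have e1 : \sum_(i in P) \sum_(j in P) y i * y j = (\sum_(i in P) y i) ^+ 2.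
  by rewrite expr2 mulr_suml; apply: eq_bigr => i _; rewrite mulr_sumr.
have e2 : \sum_(i in P) \sum_(j in P) y j ^+ 2 = #|P|%:R * \sum_(i in P) y i ^+ 2.
  by rewrite sumr_const mulr_natl.
have e3 : \sum_(i in P) \sum_(j in P) y i ^+ 2 = #|P|%:R * \sum_(i in P) y i ^+ 2.
  by rewrite exchange_big.
rewrite -e1 mulrBr mulrDl mul1r -{1}e2 -e3 mulr_sumr -big_split /= -sumrB.
apply: eq_bigr => i _; rewrite mulr_sumr -big_split -sumrB /=.
by apply: eq_bigr => j _; ring.
Qed.

Section Maclaurin.
Context {R : realFieldType} {T : finType} (y : T -> R)
  (y0 : forall i, 0 <= y i).
Local Notation e := (elem_sym y).

Let sum_mem_prod k (G : {set T} -> R) :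
  \sum_(B : {set T} | #|B| == k) \sum_(w in B) (\prod_(i in B :\ w) y i) * y w * G B
  = k%:R * \sum_(B : {set T} | #|B| == k) (\prod_(i in B) y i) * G B.
Proof.
rewrite mulr_sumr; apply: eq_bigr => B /eqP cB.
transitivity (\sum_(w in B) (\prod_(i in B) y i) * G B).
  by apply: eq_bigr => w wB; rewrite [in RHS](big_setD1 w) //= [y w * _]mulrC.
by rewrite sumr_const cB mulr_natl.
Qed.

Lemma elem_symS k : k.+1%:R * e k.+1 =
  \sum_(A : {set T} | #|A| == k) (\prod_(i in A) y i) * \sum_(w | w \notin A) y w.
Proof.
under eq_bigr => A _ do rewrite mulr_sumr.
rewrite (sum_subset_add _ (fun A w => (\prod_(i in A) y i) * y w)).
have := sum_mem_prod k.+1 (fun=> 1).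
under eq_bigr => B _ do under eq_bigr => w _ do rewrite mulr1.
by move=> ->; congr (_ * _); apply: eq_bigr => B _; rewrite mulr1.
Qed.

(* For the normalised means p_k this says p_(k+1) <= p_1 p_k. Summing, over the
   sets B with one element fewer than k, the Cauchy-Schwarz inequality for the
   values of y outside B yields it without Newton's inequalities. *)
Lemma elem_sym_ratio k : (k < #|T|)%N ->
  k.+1%:R * #|T|%:R * e k.+1 <= (#|T| - k)%:R * (\sum_i y i) * e k.
Proof.
case: k => [|k] kT.
  have e0 : e 0%N = 1.
    rewrite /elem_sym (big_pred1 finset.set0) ?big_set0 //.
    by move=> A /=; rewrite cards_eq0.
  have := elem_symS 0; rewrite (big_pred1 finset.set0) ?big_set0; last first.
    by move=> A /=; rewrite cards_eq0.
  rewrite e0 mul1r subn0 mulr1 mulrAC => ->.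
  rewrite mulrC ler_wpM2l // le_eqVlt; apply/orP; left; apply/eqP.
  by apply: eq_bigl => i; rewrite inE.
(* [Q] collects the monomials with one squared variable in the product of the plain sum and
   [e k.+1]. *)
pose Q := \sum_(A : {set T} | #|A| == k.+1) (\prod_(i in A) y i) * \sum_(w in A) y w.
have e1e : (\sum_i y i) * e k.+1 = Q + k.+2%:R * e k.+2.
  rewrite elem_symS /Q -big_split /= /elem_sym mulr_sumr; apply: eq_bigr => A _.
  rewrite -mulrDr mulrC; congr (_ * _).
  by rewrite (bigID (fun i => i \in A)) /=.
have QE : Q = \sum_(B : {set T} | #|B| == k)
    (\prod_(i in B) y i) * \sum_(w | w \notin B) y w ^+ 2.
  under [RHS]eq_bigr => A _ do rewrite mulr_sumr.
  rewrite (sum_subset_add _ (fun A w => (\prod_(i in A) y i) * y w ^+ 2)).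
  apply: eq_bigr => B _; rewrite mulr_sumr; apply: eq_bigr => w wB.
  by rewrite (big_setD1 w) //=; ring.
(* Expanding the square, the diagonal terms give [Q] and the others extend [B] by two distinct
   points. *)
have sqE : \sum_(B : {set T} | #|B| == k)
    (\prod_(i in B) y i) * (\sum_(w | w \notin B) y w) ^+ 2 =
    Q + k.+1%:R * (k.+2%:R * e k.+2).
  rewrite [in RHS]elem_symS -sum_mem_prod QE.
  pose F (A : {set T}) w := (\prod_(i in A) y i) * y w *
    \sum_(v | v \notin (w |: A)%SET) y v.
  have := sum_subset_add k F.
  have -> : \sum_(B : {set T} | #|B| == k.+1) \sum_(w in B) F (B :\ w)%SET w =
      \sum_(B : {set T} | #|B| == k.+1) \sum_(w in B)
        (\prod_(i in B :\ w) y i) * y w * \sum_(v | v \notin B) y v.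
    by apply: eq_bigr => B _; apply: eq_bigr => w wB; rewrite /F finset.setD1K.
  move=> <-; rewrite -big_split; apply: eq_bigr => B _ /=.
  transitivity (\sum_(w | w \notin B)
     (\prod_(i in B) y i) * y w * \sum_(v | v \notin B) y v).
    by rewrite -mulr_suml -mulr_sumr expr2 mulrA.
  rewrite mulr_sumr -big_split /=.
  apply: eq_bigr => w wB; rewrite /F [\sum_(v | v \notin B) y v](bigD1 w) //=.
  have -> : \sum_(i | (i \notin B) && (i != w)) y i =
     \sum_(v | v \notin (w |: B)%SET) y v.
    by apply: eq_bigl => i; rewrite !inE negb_or andbC.
  by ring.
have sqle : \sum_(B : {set T} | #|B| == k)
    (\prod_(i in B) y i) * (\sum_(w | w \notin B) y w) ^+ 2 <= (#|T| - k)%:R * Q.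
  rewrite QE mulr_sumr; apply: ler_sum => B /eqP cB.
  rewrite [leRHS]mulrCA; apply: ler_wpM2l; first by apply: prodr_ge0.
  have -> : (#|T| - k)%N = #|(~: B)%SET| by rewrite cardsCs finset.setCK cB.
  have := sum_sqr_le (~: B)%SET y.
  have CB F : \sum_(i in (~: B)%SET) F i = \sum_(i | i \notin B) F i :> R.
    by apply: eq_bigl => i; rewrite inE.
  by rewrite !CB.
have h : Q + k.+1%:R * (k.+2%:R * e k.+2) <= (#|T| - k)%:R * Q by rewrite -sqE.
(* Both [h] and the goal amount to (k + 1)(k + 2) e_(k+2) <= (|T| - k - 1) Q. *)
rewrite -[leRHS]mulrA e1e; move: h.
rewrite (natrB _ (ltnW kT)) (natrB _ (ltnW (ltnW kT))).
rewrite -!(natr1 k.+1) -!(natr1 k).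
set n : R := #|T|%:R; set E := e _; set q := Q; set c : R := k%:R.
by move=> h; lra.
Qed.

Lemma maclaurin_elem_sym k : (k <= #|T|)%N ->
  e k * #|T|%:R ^+ k <= 'C(#|T|, k)%:R * (\sum_i y i) ^+ k.
Proof.
elim: k => [|k IH] kT.
  rewrite /elem_sym (big_pred1 finset.set0) ?big_set0 ?bin0 ?mulr1 //.
  by move=> A /=; rewrite cards_eq0.
have S0 : 0 <= \sum_i y i by apply: sumr_ge0.
have {IH} IH := IH (ltnW kT).
rewrite -(ler_pM2l (ltr0Sn _ k)) !mulrA -natrM mul_bin_left natrM.
have -> : k.+1%:R * e k.+1 * #|T|%:R ^+ k.+1 =
   k.+1%:R * #|T|%:R * e k.+1 * #|T|%:R ^+ k by rewrite exprS; ring.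
apply: (le_trans (ler_wpM2r _ (elem_sym_ratio k kT))); first by rewrite exprn_ge0.
rewrite -[X in X <= _]mulrA.
apply: (le_trans (ler_wpM2l _ IH)); first by rewrite mulr_ge0.
by rewrite exprS le_eqVlt; apply/orP; left; apply/eqP; ring.
Qed.

End Maclaurin.

(** * Bernstein's inequality without replacement *)

Lemma le_of_is_derive {R : realType} (f df : R -> R) (a b : R) : a <= b ->
  (forall x : R, is_derive x 1 f (df x)) ->
  (forall x, a <= x <= b -> 0 <= df x) -> f a <= f b.
Proof.
move=> ab fdf df0.
have [|c cab E] := @MVT_segment R f df a b ab (fun x _ => fdf x).
  by apply: derivable_within_continuous => x _; case: (fdf x).
by rewrite -subr_ge0 E mulr_ge0 ?subr_ge0 ?df0 //.
Qed.

(* The [2/1] Pade approximant bounds the exponential in this form on the whole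
   line: the difference of both sides, divided by expR y, has derivative
   2 - (2 + 2y + y^2) / expR y, which has the sign of y. *)
Lemma expR_pade {R : realType} (y : R) :
  expR y * (6 - 2 * y) <= 6 + 4 * y + y ^+ 2.
Proof.
pose g (x : R) : R := (6 + 4 * x + x ^+ 2) * expR (- x) + 2 * x.
pose dg (x : R) : R := 2 - (2 + 2 * x + x ^+ 2) * expR (- x).
have gdg (x : R) : is_derive x 1 g (dg x).
  by rewrite /g /dg; apply: is_derive_eq; rewrite /GRing.scale /=; ring.
have dgd (x : R) : is_derive x 1 dg (x ^+ 2 * expR (- x)).
  by rewrite /dg; apply: is_derive_eq; rewrite /GRing.scale /=; ring.
have dgle (u v : R) : u <= v -> dg u <= dg v.
  move=> uv; apply: (le_of_is_derive _ _ _ _ uv dgd) => x _.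
  by rewrite mulr_ge0 ?sqr_ge0 ?expR_ge0.
have dg0 : dg 0 = 0 by rewrite /dg oppr0 expR0; ring.
have g0 : g 0 = 6 by rewrite /g oppr0 expR0; ring.
have gE : 6 <= g y.
  rewrite -g0; case: (leP 0 y) => y0.
    apply: (le_of_is_derive _ _ _ _ y0 gdg) => x /andP[x0 _].
    by rewrite -dg0 dgle.
  rewrite -lerN2; apply: (le_of_is_derive (fun x => - g x)
    (fun x => - dg x) _ _ (ltW y0)).
  by move=> x /andP[_ x0]; rewrite oppr_ge0 -dg0 dgle.
have : 6 - 2 * y <= (6 + 4 * y + y ^+ 2) * expR (- y) by rewrite lerBlDr.
rewrite -(ler_pM2l (expR_gt0 y)) => /le_trans; apply.
by rewrite mulrCA -expRD subrr expR0 mulr1.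
Qed.

(** The bound of [expR_pade] equals 1 + y + y^2 / (2 (1 - y/3)). At y = u x, replacing y by u >= u x
    in the denominator leaves a quadratic in x, which sums through mean and variance. *)
Lemma expR_bernstein {R : realType} (u x : R) : 0 <= u < 3 -> `|x| <= 1 ->
  expR (u * x) <= 1 + u * x + u ^+ 2 * x ^+ 2 / (2 * (1 - u / 3)).
Proof.
move=> /andP[u0 u3] /ler_normlP[xl xr].
have ux : u * x <= u by rewrite -[leRHS]mulr1 ler_wpM2l.
have := expR_pade (u * x).
have d0 : 0 < 6 - 2 * (u * x) by lra.
rewrite -ler_pdivlMr // => /le_trans; apply.
rewrite -subr_ge0.
have -> : 1 + u * x + u ^+ 2 * x ^+ 2 / (2 * (1 - u / 3)) -
  (6 + 4 * (u * x) + (u * x) ^+ 2) / (6 - 2 * (u * x)) =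
  (u * x) ^+ 2 * (2 * (u - u * x)) / ((2 * (1 - u / 3)) * (6 - 2 * (u * x))).
  by field; apply/andP; split; apply/eqP; lra.
apply: divr_ge0; rewrite mulr_ge0 ?sqr_ge0 //; lra.
Qed.

(* Chernoff's method for sampling without replacement: the exponential moment
   of the sum over a random k-set is a normalised elementary symmetric
   polynomial, bounded by the k-th power of the mean by Maclaurin. *)
Lemma bernstein_without_replacement {R : realType} {T : finType} (X : T -> R)
    (k : nat) (v tau : R) :
  (k <= #|T|)%N -> 0 < v -> 0 <= tau ->
  (forall i, `|X i| <= 1) -> \sum_i X i = 0 ->
  \sum_i X i ^+ 2 <= v * #|T|%:R ->
  #|[set A : {set T} | (#|A| == k) && (k%:R * tau <= \sum_(i in A) X i)]%SET|%:R
  <= 'C(#|T|, k)%:R * expR (- (k%:R * (tau ^+ 2 / (2 * (v + tau / 3))))).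
Proof.
move=> kT v0 tau0 X1 sX sX2.
have [T0|T0] := posnP #|T|.
  have k0 : k = 0%N by apply/eqP; move: kT; rewrite T0 leqn0.
  rewrite k0 !mul0r oppr0 expR0 mulr1 bin0 ler_nat.
  rewrite (leq_trans (max_card _)) //.
  by rewrite -cardsT -powersetT card_powerset cardsT T0.
(* Chernoff parameter: it makes c = u tau / 2, so that c - u tau is the announced exponent per
   draw. *)
pose u := tau / (v + tau / 3).
have w0 : 0 < v + tau / 3 by rewrite ltr_wpDr // divr_ge0.
have u0 : 0 <= u by rewrite divr_ge0 // ltW.
have u3 : u < 3 by rewrite ltr_pdivrMr //; lra.
have u13 : 1 - u / 3 = v / (v + tau / 3).
  by rewrite /u; field; apply/eqP; lra.
pose y i := expR (u * X i).
have y0 i : 0 <= y i by apply: expR_ge0.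
pose c := u ^+ 2 * v / (2 * (1 - u / 3)).
have d0 : 0 < 2 * (1 - u / 3) by rewrite u13 mulr_gt0 // divr_gt0.
have sy : \sum_i y i <= #|T|%:R * expR c.
  apply: (@le_trans _ _ (#|T|%:R * (1 + c))); last first.
    by rewrite ler_wpM2l // expR_ge1Dx.
  apply: (@le_trans _ _ (\sum_i (1 + u * X i +
     u ^+ 2 / (2 * (1 - u / 3)) * X i ^+ 2))).
    apply: ler_sum => i _; have u03 : 0 <= u < 3 by rewrite u0.
    apply: le_trans (expR_bernstein u (X i) u03 (X1 i)) _.
    by rewrite [u ^+ 2 / _ * _]mulrAC.
  rewrite !big_split /= -!mulr_sumr sX mulr0 addr0 sumr_const.
  rewrite [leRHS]mulrDr mulr1; apply: lerD => //.
  have -> : #|T|%:R * c = u ^+ 2 / (2 * (1 - u / 3)) * (v * #|T|%:R).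
    by rewrite /c; ring.
  by rewrite ler_wpM2l // divr_ge0 ?sqr_ge0 ?ltW.
have nT0 : 0 < #|T|%:R :> R by rewrite ltr0n.
have mac : elem_sym y k <= 'C(#|T|, k)%:R * expR c ^+ k.
  rewrite -(ler_pM2r (exprn_gt0 k nT0)).
  apply: le_trans (maclaurin_elem_sym y y0 k kT) _.
  rewrite -mulrA; apply: ler_wpM2l => //.
  rewrite mulrC -exprMn; apply: lerXn2r sy; rewrite nnegrE.
    by apply: sumr_ge0.
  by rewrite mulr_ge0 ?expR_ge0.
have -> : - (k%:R * (tau ^+ 2 / (2 * (v + tau / 3)))) =
    k%:R * c - u * (k%:R * tau).
  rewrite /c u13 /u; field.
  by do 2?[apply/andP; split]; apply/eqP; lra.
rewrite expRD mulrA expRN ler_pdivlMr ?expR_gt0 //.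
move: mac; rewrite -expRM_natl => mac.
(* Markov's inequality as a count: each counted [A] contributes at least
   [expR (u * (k%:R * tau))]. *)
rewrite (le_trans _ mac) // /elem_sym.
rewrite -sum1_card natr_sum mulr_suml.
under eq_bigl => A do rewrite inE.
rewrite big_mkcondr /=; apply: ler_sum => A _.
case: ifP => [H|_]; last by apply: prodr_ge0.
by rewrite mul1r /y -expR_sum ler_expR -mulr_sumr ler_wpM2l.
Qed.

(** * Trigonometric sums and regular polygons *)

Lemma sinD2pin {R : realType} (x : R) (m : nat) : sin (x + 2 * pi * m%:R) = sin x.
Proof.
rewrite -[RHS](periodicn (@sinD2pi R) m); congr (sin (_ + _)).
by rewrite -[RHS]mulr_natr -[pi *+ 2]mulr_natl.
Qed.

(** Multiplied by 2 sin(al/2), the sum telescopes, and its two ends differ by [m] full turns. *)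
Lemma sum_cos_arith {R : realType} (n m : nat) (al th : R) :
  sin (al / 2) != 0 -> n%:R * al = 2 * pi * m%:R ->
  \sum_(w < n) cos (w%:R * al - th) = 0.
Proof.
move=> s0 nal; apply: (mulfI (_ : 2 * sin (al / 2) != 0)).
  by rewrite mulf_neq0.
rewrite mulr0 mulr_sumr.
pose F (k : nat) := sin (k%:R * al - th - al / 2).
rewrite (eq_bigr (fun w : 'I_n => F w.+1 - F w)) => [|w _]; last first.
  have -> : F w.+1 = sin ((w%:R * al - th) + al / 2).
    by rewrite /F -natr1; congr sin; field.
  by rewrite /F; set x := _ - th; rewrite (sinD x (al / 2)) (sinB x (al / 2)); ring.
rewrite -(big_mkord xpredT (fun k => F k.+1 - F k)) telescope_sumr //.
apply/eqP; rewrite subr_eq0 /F nal mul0r; apply/eqP.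
rewrite -[RHS](sinD2pin _ m); congr sin; ring.
Qed.

Lemma sin_neq0_2pi {R : realType} (x : R) :
  0 < x < 2 * pi -> x != pi -> sin x != 0.
Proof.
move=> /andP[x0 x2] xpi; case: (ltrP x pi) => h.
  by rewrite gt_eqF // sin_gt0_pi // x0.
have h' : pi < x by rewrite lt_neqAle eq_sym xpi.
rewrite -[x](subrK pi) sinDpi oppr_eq0 gt_eqF // sin_gt0_pi //.
by apply/andP; split; lra.
Qed.

Lemma sin_lattice_neq0 {R : realType} (n d : nat) :
  (0 < d < 2 * n)%N -> d != n -> sin (pi * d%:R / n%:R : R) != 0.
Proof.
move=> /andP[d0 dn] ndn; have n0 : (0 < n)%N by lia.
have n0R : 0 < n%:R :> R by rewrite ltr0n.
have d0R : 0 < d%:R :> R by rewrite ltr0n.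
have pi0 := pi_gt0 R.
apply: sin_neq0_2pi.
  rewrite divr_gt0 ?mulr_gt0 // ltr_pdivrMr //= mulrAC mulrC ltr_pM2r //.
  by rewrite -natrM ltr_nat.
rewrite -subr_eq0.
have -> : pi * d%:R / n%:R - pi = pi * (d%:R - n%:R) / n%:R :> R.
  by field; rewrite gt_eqF.
rewrite mulf_neq0 ?invr_neq0 ?(gt_eqF n0R) // mulf_neq0 ?(gt_eqF pi0) //.
by rewrite subr_eq0 eqr_nat.
Qed.

(** The range of [d] reaches [2 * n] so that the doubled frequency of [sum_cos2_lattice] is
    covered. *)
Lemma sum_cos_lattice {R : realType} (n d : nat) (th : R) :
  (0 < d < 2 * n)%N -> d != n ->
  \sum_(w < n) cos (2 * pi * w%:R * d%:R / n%:R - th) = 0.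
Proof.
move=> dn ndn; have n0 : (0 < n)%N by lia.
have n0R : n%:R != 0 :> R by rewrite pnatr_eq0 -lt0n.
rewrite -[RHS](@sum_cos_arith R n d (2 * pi * d%:R / n%:R) th); last 2 first.
- have -> : 2 * pi * d%:R / n%:R / 2 = pi * d%:R / n%:R :> R by field.
  exact: sin_lattice_neq0.
- by field.
by apply: eq_bigr => w _; congr (cos (_ - _)); ring.
Qed.

Lemma sum_cos2_lattice {R : realType} (n d : nat) (th : R) :
  (0 < d < n)%N -> (2 * d != n)%N ->
  \sum_(w < n) cos (2 * pi * w%:R * d%:R / n%:R - th) ^+ 2 = 2^-1 * n%:R :> R.
Proof.
move=> dn ndn.
have E (w : 'I_n) : cos (2 * pi * w%:R * d%:R / n%:R - th) ^+ 2 =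
   2^-1 + 2^-1 * cos (2 * pi * w%:R * (2 * d)%:R / n%:R - 2 * th) :> R.
  have -> : 2 * pi * w%:R * (2 * d)%:R / n%:R - 2 * th =
     (2 * pi * w%:R * d%:R / n%:R - th) *+ 2 :> R by rewrite natrM; ring.
  by rewrite cos_mulr2n; field.
rewrite (eq_bigr _ (fun w _ => E w)) big_split /= sumr_const card_ord.
by rewrite -mulr_sumr sum_cos_lattice ?mulr0 ?addr0 ?mulr_natr //; lia.
Qed.

Lemma polar_form {R : realType} (x y : R) :
  exists2 phi : R, 0 <= phi <= 2 * pi &
    x = Num.sqrt (x ^+ 2 + y ^+ 2) * cos phi /\
    y = Num.sqrt (x ^+ 2 + y ^+ 2) * sin phi.
Proof.
have pi0 := pi_gt0 R.
set r := Num.sqrt _.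
have r0 : 0 <= r by rewrite sqrtr_ge0.
have rE : r ^+ 2 = x ^+ 2 + y ^+ 2 by rewrite sqr_sqrtr // addr_ge0 ?sqr_ge0.
move: r0; rewrite le_eqVlt => /orP[/eqP r0|r0].
  exists 0; first by apply/andP; split; lra.
  move: rE; rewrite -r0 !mul0r expr0n /= => /esym/eqP.
  by rewrite paddr_eq0 ?sqr_ge0 // !sqrf_eq0 => /andP[/eqP -> /eqP ->].
have nr0 : r != 0 by rewrite gt_eqF.
pose c := x / r.
have c2 : 1 - c ^+ 2 = (`|y| / r) ^+ 2.
  rewrite /c !expr_div_n real_normK ?num_real // rE.
  by field; rewrite -rE sqrf_eq0.
have c1 : -1 <= c <= 1.
  rewrite -ler_norml -(@ler_pXn2r _ 2) ?nnegrE // real_normK ?num_real //.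
  by rewrite expr1n -subr_ge0 c2 sqr_ge0.
have ca : cos (acos c) = c by apply: acosK; rewrite in_itv.
have sa : sin (acos c) = `|y| / r.
  by rewrite sin_acos // c2 sqrtr_sqr ger0_norm // divr_ge0 // ltW.
have a0 := acos_ge0 c1; have ap := acos_lepi c1.
case: (lerP 0 y) => y0.
  exists (acos c); first by apply/andP; split; lra.
  by rewrite ca sa /c ger0_norm //; split; field.
exists (2 * pi - acos c); first by apply/andP; split; lra.
have -> : 2 * pi - acos c = - acos c + pi *+ 2 by rewrite -[pi *+ 2]mulr_natl addrC.
by rewrite cosD2pi sinD2pi cosN sinN ca sa /c ltr0_norm //; split; field.
Qed.

Lemma cos_ge_of_norm_le {R : realType} (x b : R) :
  `|x| <= b -> b <= pi -> cos b <= cos x.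
Proof.
move=> xb bpi; have -> : cos x = cos `|x|.
  by case: (lerP 0 x) => x0; rewrite ?(ger0_norm x0) // ltr0_norm // cosN.
have b0 : 0 <= b by apply: le_trans xb.
rewrite leNgt ltr_cos ?in_itv /= ?b0 ?normr_ge0 //= -?leNgt //.
exact: le_trans bpi.
Qed.

(** Some vertex direction lies within pi/n of the argument of (x, y). *)
Lemma polygon_norm {R : realType} (n : nat) (x y : R) : (3 <= n)%N ->
  exists k : 'I_n, cos (pi / n%:R) * Num.sqrt (x ^+ 2 + y ^+ 2) <=
    x * cos (2 * pi * k%:R / n%:R) + y * sin (2 * pi * k%:R / n%:R).
Proof.
move=> n3; have n0 : (0 < n)%N by lia.
have pi0 := pi_gt0 R.
have n0R : 0 < n%:R :> R by rewrite ltr0n.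
have n1R : 1 <= n%:R :> R by rewrite ler1n.
have [phi /andP[p0 p2] [xE yE]] := polar_form x y.
set r := Num.sqrt _ in xE yE *.
have r0 : 0 <= r by rewrite sqrtr_ge0.
suff [k kE] : exists k : 'I_n, cos (pi / n%:R) <= cos (phi - 2 * pi * k%:R / n%:R).
  exists k; rewrite xE yE -!(mulrA r) -mulrDr -cosB [leLHS]mulrC.
  by rewrite ler_wpM2l.
(* The added 1/2 turns truncation into rounding to the nearest vertex. *)
pose t := phi * n%:R / (2 * pi) + 2^-1.
have t0 : 0 <= t by rewrite addr_ge0 ?invr_ge0 // divr_ge0 ?mulr_ge0 // ltW.
have /andP[kt tk] := truncn_itv t0.
set k := Num.truncn t in kt tk.
have tn : t < n.+1%:R.
  rewrite /t -(natr1 n); apply: ler_ltD; last by lra.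
  by rewrite ler_pdivrMr ?mulr_gt0 // mulrC ler_wpM2l // ltW.
have kn : (k <= n)%N by rewrite -ltnS -(ltr_nat R) (le_lt_trans kt).
have phiE : phi = (t - 2^-1) * (2 * pi / n%:R).
  have pi_neq0 := gt_eqF pi0; rewrite /t addrK; move: pi_neq0; move: pi => p pn0.
  by field; rewrite pn0 gt_eqF.
have near : `|phi - 2 * pi * k%:R / n%:R| <= pi / n%:R.
  have -> : phi - 2 * pi * k%:R / n%:R = (2 * (t - k%:R) - 1) * (pi / n%:R).
    by rewrite phiE; field; rewrite gt_eqF.
  have q0 : 0 <= pi / n%:R :> R by rewrite divr_ge0 // ltW.
  rewrite normrM (ger0_norm q0) ler_piMl // ler_norml.
  by move: tk; rewrite -(natr1 k) => tk; apply/andP; split; lra.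
have bpi : pi / n%:R <= pi :> R by rewrite ler_pdivrMr // ler_peMr // ltW.
have close := cos_ge_of_norm_le _ _ near bpi.
case: (ltnP k n) => nk; first by exists (Ordinal nk).
(* Rounding up to a full turn: vertex [n] is vertex 0. *)
have {nk kn} kE : k = n by apply/eqP; rewrite eqn_leq kn.
exists (Ordinal n0); apply: (le_trans close); rewrite kE /= mulr0 mul0r subr0.
rewrite mulfK ?gt_eqF // -(cosD2pi (phi - 2 * pi)).
by rewrite -[pi *+ 2]mulr_natl subrK.
Qed.

(** * Recovery from small exponential sums *)

Lemma normc_ge0 {R : rcfType} (z : R[i]) : 0 <= normc z.
Proof. by case: z => x y; apply: sqrtr_ge0. Qed.

Lemma normc_sum_le {R : rcfType} {I : finType} (P : pred I) (F : I -> R[i]) :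
  normc (\sum_(i | P i) F i) <= \sum_(i | P i) normc (F i).
Proof.
elim/big_ind2: _ => [|x1 x2 y1 y2 h1 h2|//]; first by rewrite ComplexField.Normc.normc0.
by apply: le_trans (le_normcD _ _) (lerD h1 h2).
Qed.

Lemma expiD {R : realType} (u v : R) : expi (u + v) = expi u * expi v.
Proof.
rewrite /expi cosD sinD; apply/eqP.
by rewrite eq_complex /= [sin u * _ + _]addrC !eqxx.
Qed.

Lemma sum_expi {R : realType} {I : finType} (P : pred I) (F : I -> R) :
  \sum_(i | P i) expi (F i) =
  Complex (\sum_(i | P i) cos (F i)) (\sum_(i | P i) sin (F i)).
Proof.
elim/big_rec3: _ => [//|i u v z _ ->].
by apply/eqP; rewrite eq_complex /= !eqxx.
Qed.

Lemma normc_sum_expiN {R : realType} {I : finType} (P : pred I) (F : I -> R) :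
  normc (\sum_(i | P i) expi (- F i)) = normc (\sum_(i | P i) expi (F i)).
Proof.
rewrite !sum_expi /=; congr Num.sqrt; congr (_ + _).
  by congr (_ ^+ _); apply: eq_bigr => i _; rewrite cosN.
by rewrite (eq_bigr (fun i => - sin (F i))) ?sumrN ?sqrrN // => i _; rewrite sinN.
Qed.

Definition exp_sum {R : realType} {N : nat} (Omega : {set 'I_N}) (d : nat) : R[i] :=
  \sum_(w in Omega) expi (2 * pi * w%:R * d%:R / N%:R).

Lemma recovery_of_exp_sum_le {R : realType} {N s : nat} {Omega : {set 'I_N}}
    {x : signal R N} :
  (0 < s)%N -> (0 < #|Omega|)%N -> (l0norm x <= s)%N ->
  (forall d, (0 < d < N)%N -> normc (exp_sum Omega d : R[i]) <=
     (if (2 * d == N)%N then 3 / 2 else 1) * (#|Omega|%:R / (2 * s%:R - 3^-1))) ->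
  property_i Omega x.
Proof.
move=> s0 Om0 xs K y yx yhat.
have s1 : 1 <= s%:R :> R by rewrite ler1n.
set f : R := #|Omega|%:R in K *.
have f0 : 0 < f by rewrite ltr0n.
set D := 2 * s%:R - 3^-1 in K.
have D0 : 0 < D by rewrite /D; lra.
pose h t := y t - x t.
pose g t := normc (h t).
have g0 t : 0 <= g t by apply: normc_ge0.
have [w0 w0Om] : exists w, w \in Omega by apply/set0Pn; rewrite -card_gt0.
have N0 : (0 < N)%N by apply: leq_ltn_trans (ltn_ord w0).
have N0R : N%:R != 0 :> R by rewrite pnatr_eq0 -lt0n.
have hhat w : w \in Omega ->
    \sum_(t < N) h t * expi (- (2 * pi * t%:R * w%:R / N%:R)) = 0.
  move=> /yhat; rewrite /fourier => /mulfI E.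
  under eq_bigr do rewrite mulrBl.
  rewrite sumrB E ?subrr //.
  rewrite -(rmorph0 (real_complex R)).
  by rewrite (inj_eq (@complexI R)) invr_eq0 sqrtr_eq0 -ltNge ltr0n.
pose ker (t t' : 'I_N) : R[i] :=
  \sum_(w in Omega) expi (2 * pi * w%:R * (t%:R - t'%:R) / N%:R).
(* After exchanging sums, only Fourier sums of [h] at frequencies in [Omega] occur. *)
have conv t : \sum_(t' < N) h t' * ker t t' = 0.
  transitivity (\sum_(w in Omega) expi (2 * pi * w%:R * t%:R / N%:R) *
     \sum_(t' < N) h t' * expi (- (2 * pi * t'%:R * w%:R / N%:R))); last first.
    by rewrite big1 // => w wO; rewrite hhat ?mulr0.
  under [RHS]eq_bigr do rewrite mulr_sumr.
  rewrite exchange_big /=; apply: eq_bigr => t' _; rewrite mulr_sumr.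
  apply: eq_bigr => w _; rewrite mulrCA -expiD; congr (_ * expi _).
  by field.
(* With truncated subtraction, [(t - t') + (t' - t)] is the distance |t - t'|; the sign does not
   affect the modulus. *)
have kernorm (t t' : 'I_N) : t' != t -> normc (ker t t') <=
    (if (2 * ((t - t') + (t' - t)) == N)%N then 3 / 2 else 1) * (f / D).
  move=> tt'; have ne : t' != t :> nat by [].
  have tN := ltn_ord t; have tN' := ltn_ord t'.
  have -> : normc (ker t t') = normc (exp_sum Omega ((t - t') + (t' - t)) : R[i]).
    rewrite /ker /exp_sum; case: (leqP t t') => tt.
      have -> : ((t - t') + (t' - t) = t' - t)%N by lia.
      rewrite -normc_sum_expiN; congr normc; apply: eq_bigr => w _.
      by congr expi; rewrite natrB //; ring.
    have -> : ((t - t') + (t' - t) = t - t')%N by lia.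
    by congr normc; apply: eq_bigr => w _; rewrite natrB // ltnW.
  by apply: K; lia.
pose tmax := [arg max_(t > w0) g t]%O.
pose M := g tmax.
have gM t : g t <= M.
  by rewrite /M /tmax; case: Order.TotalTheory.arg_maxP => // i _; apply.
pose L := \sum_t g t.
have opposite_le t :
    \sum_(t' < N | (t' != t) && (2 * ((t - t') + (t' - t)) == N)%N) g t' <= M.
  have [t' /andP[tt' ht']|none] := pickP (fun t' : 'I_N =>
      (t' != t) && (2 * ((t - t') + (t' - t)) == N)%N); last first.
    by rewrite big_pred0 // g0.
  rewrite (big_pred1 t') // => t2 /=; apply/idP/eqP => [/andP[_ /eqP h2]|->].
    apply: val_inj => /=; move: (ltn_ord t2) (ltn_ord t) (ltn_ord t') ht'.
    by move=> ? ? ? /eqP; lia.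
  by rewrite tt'.
(* The convolution identity at [tmax], where [h] is largest; the excess 3/2 - 1 = 1/2 is paid only
   at the antipode, whose value is at most [M]. *)
have fM : f * M <= (f / D) * (L - M) + (f / D / 2) * M.
  have := conv tmax; rewrite (bigD1 tmax) //=.
  have -> : ker tmax tmax = real_complex R f.
    rewrite /ker sum_expi; apply/eqP; rewrite eq_complex /=; apply/andP; split.
      rewrite (eq_bigr (fun=> 1)) ?sumr_const // => w _.
      by rewrite subrr mulr0 mul0r cos0.
    by rewrite big1 // => w _; rewrite subrr mulr0 mul0r sin0.
  move=> /eqP; rewrite addr_eq0 => /eqP E.
  have -> : f * M = normc (h tmax * real_complex R f).
    rewrite ComplexField.Normc.normcM mulrC; congr (_ * _).
    by rewrite /= expr0n /= addr0 sqrtr_sqr ger0_norm // ltW.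
  rewrite E normcN; apply: le_trans (normc_sum_le _ _) _.
  apply: (@le_trans _ _ (\sum_(t' < N | t' != tmax) ((f / D) * g t' +
     (f / D / 2) *
     (if (2 * ((tmax - t') + (t' - tmax)) == N)%N then g t' else 0)))).
    apply: ler_sum => t' tt'; rewrite ComplexField.Normc.normcM.
    apply: le_trans (ler_wpM2l (g0 t') (kernorm _ _ tt')) _.
    rewrite le_eqVlt; apply/orP; left; apply/eqP.
    by case: ifP => _; field; rewrite gt_eqF.
  rewrite big_split /= -!mulr_sumr -big_mkcondr; apply: lerD.
    apply: ler_wpM2l; first by rewrite divr_ge0 // ltW.
    have -> : L = M + \sum_(t' | t' != tmax) g t' by rewrite /L (bigD1 tmax).
    by rewrite addrAC subrr add0r.
  by apply: ler_wpM2l => //; rewrite divr_ge0 // divr_ge0 // ltW.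
(* Here D + 1/2 = 2 s + 1/6: the antipode still leaves a margin over 2 s. *)
have LM : (2 * s%:R + 6^-1) * M <= L.
  have E : f * M - ((f / D) * (L - M) + (f / D / 2) * M) =
      (f / D) * ((D + 2^-1) * M - L) by field; rewrite gt_eqF.
  have : f / D * ((D + 2^-1) * M - L) <= 0 by rewrite -E subr_le0.
  by rewrite pmulr_rle0 ?divr_gt0 // subr_le0 /D; lra.
have M0 : 0 < M.
  rewrite lt_neqAle g0 andbT eq_sym; apply/eqP => M0; apply: yx.
  apply/ffunP => t; apply/eqP; rewrite -subr_eq0; apply/eqP.
  by apply: ComplexField.Normc.eq0_normc; apply/eqP; rewrite eq_le g0 andbT -M0 gM.
pose S := [set t | x t != 0]%SET.
have gS : \sum_(t in S) g t <= s%:R * M.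
  apply: (@le_trans _ _ (\sum_(t in S) M)); first by apply: ler_sum.
  by rewrite sumr_const mulr_natl; apply: (ler_wpMn2l (ltW M0)).
have LS : L = \sum_(t in S) g t + \sum_(t | t \notin S) g t.
  by rewrite /L (bigID (fun t => t \in S)).
have half : \sum_(t in S) g t < \sum_(t | t \notin S) g t by lra.
rewrite /l1norm (bigID (fun t => t \in S)) [ltRHS](bigID (fun t => t \in S)) /=.
rewrite [X in _ + X < _]big1 => [|t]; last first.
  by rewrite inE negbK => /eqP ->; rewrite ComplexField.Normc.normc0.
rewrite addr0 (eq_bigr g (P := fun t => t \notin S)) => [|t]; last first.
  by rewrite inE negbK /g /h => /eqP ->; rewrite subr0.
have xle : \sum_(t in S) normc (x t) <=
    \sum_(t in S) normc (y t) + \sum_(t in S) g t.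
  rewrite -big_split; apply: ler_sum => t _ /=.
  rewrite /g -[normc (h t)]normcN /h opprB.
  by apply: le_trans (le_normcD _ _); rewrite addrC subrK.
lra.
Qed.

(** * Tail bound for the exponential sums *)

Lemma card_bigcup_le {I T : finType} (P : pred I) (F : I -> {set T}) :
  (#|\bigcup_(i | P i) F i|%SET <= \sum_(i | P i) #|F i|)%N.
Proof.
elim/big_ind2: _ => [|m A n B Am Bn|//]; first by rewrite cards0.
by apply: leq_trans (leq_of_leqif (leq_card_setU A B)) (leq_add Am Bn).
Qed.

(** A long sum has, by [polygon_norm], one of [nu] projections at least [f%:R * tau]. Each
    projection is a centred subset sum, so Bernstein and a union bound over the polygon apply. *)
Lemma exp_sum_tail {R : realType} (N f nu d : nat) (v tau : R) :
  (3 <= nu)%N -> (0 < d < N)%N -> (f <= N)%N -> 0 < v -> 0 <= tau ->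
  (forall th : R,
    \sum_(w < N) cos (2 * pi * w%:R * d%:R / N%:R - th) ^+ 2 <= v * N%:R) ->
  #|[set A : {set 'I_N} | (#|A| == f) &&
      (f%:R * tau < cos (pi / nu%:R) * normc (exp_sum A d : R[i]))]%SET|%:R
  <= nu%:R * ('C(N, f)%:R *
       expR (- (f%:R * (tau ^+ 2 / (2 * (v + tau / 3)))))).
Proof.
move=> nu3 dN fN v0 tau0 sq; set W := [set A | _]%SET.
pose X (k : 'I_nu) (w : 'I_N) : R :=
  cos (2 * pi * w%:R * d%:R / N%:R - 2 * pi * k%:R / nu%:R).
pose B k := [set A : {set 'I_N} | (#|A| == f) &&
  (f%:R * tau <= \sum_(w in A) X k w)]%SET.
have WB : W \subset (\bigcup_k B k)%SET.
  apply/fintype.subsetP => A; rewrite inE => /andP[Af tA].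
  pose x : R := \sum_(w in A) cos (2 * pi * w%:R * d%:R / N%:R).
  pose y : R := \sum_(w in A) sin (2 * pi * w%:R * d%:R / N%:R).
  have [k kE] := polygon_norm nu x y nu3.
  apply/finset.bigcupP; exists k => //; rewrite inE Af /=.
  apply: ltW; apply: (lt_le_trans tA); rewrite /exp_sum sum_expi /=.
  apply: (le_trans kE); rewrite /x /y !mulr_suml -big_split /=.
  by apply: ler_sum => w _; rewrite /X cosB.
apply: (@le_trans _ _ (\sum_(k < nu) #|B k|)%:R).
  by rewrite ler_nat (leq_trans (subset_leq_card WB)) // card_bigcup_le.
rewrite natr_sum mulr_natl -[X in _ *+ X]card_ord -sumr_const.
apply: ler_sum => k _; rewrite -[X in 'C(X, _)]card_ord.
apply: bernstein_without_replacement; rewrite ?card_ord //.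
- by move=> w; rewrite ler_norml cos_geN1 cos_le1.
- by apply: sum_cos_lattice; lia.
- exact: sq.
Qed.

(** * Comparison of exponents and union bound over the frequencies *)

Theorem mainTheorem3 (R : realType) (N s : nat) (C eps : R) (f nu : nat)
    (hN : (1 <= N)%N) (hs : (1 <= s)%N)
    (hC : 1 < C) (heps0 : 0 < eps) (heps1 : eps < 12%:R^-1)
    (hf : f%:R = 4 * C * (1 + eps) * (s%:R ^+ 2 + 1) * ln (N%:R : R))
    (hf0 : (0 < f)%N) (hfN : (f < N)%N) (hnu : (3 <= nu)%N)
    (a delta : R) (ha : a = cos (pi / nu%:R)) (hdelta : delta = C * a ^+ 2 - 1) :
  uniform_subset_prob R f (fun Omega : {set 'I_N} =>
    forall x : signal R N, (l0norm x <= s)%N -> property_i Omega x)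
  > 1 - nu%:R * (N%:R : R) `^ (- delta)
      - (N%:R : R) `^ (- (C * eps ^+ 2 * (1 + eps) * (s%:R ^+ 2 + 1))).
Proof.
have pi0 := pi_gt0 R.
have N0 : 0 < N%:R :> R by rewrite ltr0n.
have s1 : 1 <= s%:R :> R by rewrite ler1n.
have lnN0 : 0 <= ln (N%:R : R) by rewrite ln_ge0 // ler1n.
have nu3 : 3 <= nu%:R :> R by rewrite ler_nat.
have nu0 : 0 < nu%:R :> R by lra.
have a0 : 0 < a.
  rewrite ha cos_gt0_pihalf // ltr_pdivlMr // ltr_pdivrMr //.
  have p3 : pi * 3 <= pi * nu%:R :> R by rewrite ler_wpM2l // ltW.
  by apply/andP; split; lra.
have a1 : a <= 1 by rewrite ha cos_le1.
pose D : R := 2 * s%:R - 3^-1.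
have D0 : 0 < D by rewrite /D; lra.
pose c d : R := if (2 * d == N)%N then 3 / 2 else 1.
pose v d : R := if (2 * d == N)%N then 1 else 2^-1.
pose tau d := a * (c d / D).
have c0 d : 0 < c d by rewrite /c; case: ifP => _; lra.
have v0 d : 0 < v d by rewrite /v; case: ifP => _; lra.
have tau0 d : 0 < tau d by rewrite mulr_gt0 // divr_gt0.
(* [q] is N^(-C a^2); the union over at most N frequencies raises it to N^(-delta). *)
pose q := expR (- (C * a ^+ 2 * ln (N%:R : R))).
have exponent d : C * a ^+ 2 * ln (N%:R : R) <=
    f%:R * (tau d ^+ 2 / (2 * (v d + tau d / 3))).
  have aD : a * D <= D by rewrite ler_piMl // ltW.
  (* For a <= 1, D^2 + 2 a D / 3 <= (D + 1/3)^2 = 4 s^2: the 1/3 in [D] absorbs Bernstein's linear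
     term. For d = N/2 the denominator 8 D^2 / 9 + 4 a D / 9 is smaller still. *)
  have key : a ^+ 2 / (4 * (s%:R ^+ 2 + 1)) <=
      tau d ^+ 2 / (2 * (v d + tau d / 3)).
    have sD : s%:R = (D + 3^-1) / 2 by rewrite /D; field.
    have D1 : 0 < D ^+ 2 by rewrite exprn_gt0.
    have aD0 : 0 < a * D by rewrite mulr_gt0.
    have s20 : 0 < 4 * (s%:R ^+ 2 + 1) :> R by rewrite mulr_gt0 // ltr_wpDl ?sqr_ge0.
    rewrite /tau /c /v; case: ifP => _.
      have -> : (a * (3 / 2 / D)) ^+ 2 / (2 * (1 + a * (3 / 2 / D) / 3)) =
          a ^+ 2 * (9 / (8 * D ^+ 2 + 4 * (a * D))).
        by field; do 2?[apply/andP; split]; apply/eqP; lra.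
      rewrite ler_wpM2l ?sqr_ge0 // ler_pdivlMr; last by lra.
      by rewrite mulrC ler_pdivrMr // sD; lra.
    have -> : (a * (1 / D)) ^+ 2 / (2 * (2^-1 + a * (1 / D) / 3)) =
        a ^+ 2 * (3 / (3 * D ^+ 2 + 2 * (a * D))).
      by field; do 2?[apply/andP; split]; apply/eqP; lra.
    rewrite ler_wpM2l ?sqr_ge0 // ler_pdivlMr; last by lra.
    by rewrite mulrC ler_pdivrMr // sD; lra.
  apply: le_trans (ler_wpM2l (ler0n _ f) key); rewrite hf.
  have -> : 4 * C * (1 + eps) * (s%:R ^+ 2 + 1) * ln (N%:R : R) *
      (a ^+ 2 / (4 * (s%:R ^+ 2 + 1))) = (1 + eps) * (C * a ^+ 2 * ln (N%:R : R)).
    field; apply/eqP; have := sqr_ge0 (s%:R : R); lra.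
  rewrite ler_peMl ?mulr_ge0 ?sqr_ge0 //; lra.
pose W d := [set A : {set 'I_N} | (#|A| == f) &&
  (f%:R * tau d < cos (pi / nu%:R) * normc (exp_sum A d : R[i]))]%SET.
have tail (d : 'I_N) : (0 < d)%N -> #|W d|%:R <= nu%:R * ('C(N, f)%:R * q).
  move=> d0; have dN : (0 < d < N)%N by rewrite d0 /=.
  apply: (@le_trans _ _ (nu%:R * ('C(N, f)%:R *
      expR (- (f%:R * (tau d ^+ 2 / (2 * (v d + tau d / 3)))))))).
    apply: exp_sum_tail => [//|//||//||th]; [exact: ltnW|exact: ltW|rewrite /v].
    case: ifP => [_|/negbT h]; last by rewrite sum_cos2_lattice.
    rewrite mul1r -[X in _ <= X%:R]card_ord -sumr_const.
    apply: ler_sum => w _.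
    by rewrite -[leRHS](cos2Dsin2 (2 * pi * w%:R * d%:R / N%:R - th)) lerDl sqr_ge0.
  apply: ler_wpM2l => //; apply: ler_wpM2l => //.
  by rewrite ler_expR lerN2.
set E := fun Omega : {set 'I_N} => _.
pose G := [set A : {set 'I_N} | (#|A| == f) && `[< E A >]]%SET.
pose U := [set A : {set 'I_N} | #|A| == f]%SET.
have cU : #|U| = 'C(N, f) by rewrite /U card_draws card_ord.
(* By [recovery_of_exp_sum_le], an f-subset where recovery fails has a long exponential sum at some
   d. *)
have UGW : U \subset (G :|: \bigcup_(d : 'I_N | (0 < d)%N) W d)%SET.
  apply/fintype.subsetP => A; rewrite !inE => Af; rewrite Af /=.
  case: asboolP => //= notE; apply/negPn/negP => notW; apply: notE => x xs.
  have cA : #|A| = f by apply/eqP.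
  apply: (@recovery_of_exp_sum_le R N s) => //; first by rewrite cA.
  move=> d /andP[d0 dN]; rewrite -[if _ then _ else _]/(c d) cA -/D leNgt.
  apply/negP => big; move/negP: notW; apply; apply/finset.bigcupP.
  exists (Ordinal dN) => //; rewrite inE Af /= /tau -ha.
  have -> : f%:R * (a * (c d / D)) = a * (c d * (f%:R / D)) by ring.
  by rewrite ltr_pM2l.
have C0 : 0 < 'C(N, f)%:R :> R by rewrite ltr0n bin_gt0 ltnW.
have count : 'C(N, f)%:R <= #|G|%:R + N%:R * (nu%:R * ('C(N, f)%:R * q)).
  rewrite -{1}cU; apply: (@le_trans _ _ (#|G| +
      \sum_(d < N | (0 < d)%N) #|W d|)%:R).
    rewrite ler_nat (leq_trans (subset_leq_card UGW)) //.
    by rewrite (leq_trans (leq_of_leqif (leq_card_setU _ _))) // leq_add2l card_bigcup_le.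
  rewrite natrD lerD2l natr_sum; apply: (le_trans (ler_sum _ tail)).
  rewrite sumr_const [leRHS]mulr_natl; apply: ler_wpMn2l.
    by rewrite !mulr_ge0 ?expR_ge0.
  by rewrite -[leqRHS]card_ord max_card.
rewrite /uniform_subset_prob -/G -/U cU ltr_pdivlMr //.
have powE r : (N%:R : R) `^ r = expR (r * ln (N%:R : R)).
  by rewrite /powR (gt_eqF N0).
rewrite powE.
have -> : expR (- delta * ln (N%:R : R)) = N%:R * q.
  rewrite -{2}[N%:R](lnK (x := N%:R)) ?posrE // /q -expRD hdelta; congr expR; ring.
have p0 := powR_gt0 (- (C * eps ^+ 2 * (1 + eps) * (s%:R ^+ 2 + 1))) N0.
set p := _ `^ _ in p0 *.
have pC : 0 < p * 'C(N, f)%:R by rewrite mulr_gt0.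
lra.
Qed.
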